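(* Let $r>0$ and $W\sim\mathrm{Poisson}(r)$. If, in the symmetric BART tree prior, the depth $D$ has the conditional distribution of $W$ given $W>0$, then for all $x,x'\in[0,1]^p$ $$k_{\mathrm{BART}}(x,x')=\frac{\sigma_\mu^2}{1-e^{-r}}\Big(\exp\big(-r\,d_{\mathrm{BART}}(x,x')\big)-e^{-r}\Big),$$ where $d_{\mathrm{BART}}(x,x')=\sum_{v=1}^pf_V(v)\,|F_S(x_v)-F_S(x'_v)|$.
   Context: Symmetric tree prior. Fix an integer $p\ge1$, $\sigma_\mu^2>0$, a probability mass function $f_D$ on the positive integers (the law of $D$), a probability mass function $f_V$ on $\{1,\dots,p\}$ with $f_V(v)>0$ for all $v$, and a continuous, strictly positive probability density $f_S$ on $[0,1]$ with distribution function $F_S$. The structure of a symmetric tree $h$ is drawn as: $D\sim f_D$; given $D$, independently $V_1,\dots,V_D$ i.i.d. from $f_V$ and $S_1,\dots,S_D$ i.i.d. from $f_S$. Points $x,x'\in[0,1]^p$ are in the same leaf, written $x\sim_hx'$, if for every $k\le D$ either both $x_{V_k},x'_{V_k}<S_k$ or both $x_{V_k},x'_{V_k}\ge S_k$. The BART kernel is $k_{\mathrm{BART}}(x,x')=\sigma_\mu^2\,\mathbb{P}[x\sim_hx']$. *)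

(* Defs.v *)
From HB Require Import structures.
From mathcomp Require Import all_boot all_order all_algebra.
From mathcomp Require Import all_classical all_reals all_analysis.
Import Order.TTheory GRing.Theory Num.Theory.
Import numFieldNormedType.Exports.

Set Implicit Arguments.
Unset Strict Implicit.
Unset Printing Implicit Defensive.

Local Open Scope classical_set_scope.
Local Open Scope ring_scope.

(* Probability mass functions on {1, 2, ...}, as functions on nat vanishing
   at 0. *)
Definition positive_nat_pmf (R : realType) (f : nat -> R) : Prop :=
  [/\ f 0%N = 0, forall n, 0 <= f n &
      (\sum_(0 <= n <oo) (f n)%:E = 1)%E].

Definition positive_finite_pmf (R : realType) (p : nat) (f : 'I_p -> R) : Prop :=
  (forall v, 0 < f v) /\ \sum_v f v = 1.

(* Only the values of f on [0, 1] matter. *)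
Definition positive_unit_density (R : realType) (f : R -> R) : Prop :=
  [/\ {within `[0, 1], continuous f},
      forall t, 0 <= t <= 1 -> 0 < f t &
      \int[lebesgue_measure]_(t in `[0, 1]) f t = 1].

Definition density_prob (R : realType) (f : R -> R) (B : set R) : R :=
  \int[lebesgue_measure]_(t in B `&` `[0, 1]) f t.

Definition density_cdf (R : realType) (f : R -> R) (t : R) : R :=
  density_prob f `]-oo, t].

Definition unit_cube (R : realType) (p : nat) (x : 'rV[R]_p) : Prop :=
  forall v, 0 <= x 0 v <= 1.

(* The structure of a symmetric tree is given by its depth n, its split
   variables V_0, ..., V_(n-1) and its thresholds S_0, ..., S_(n-1); the values
   of V and S at indices >= n are irrelevant. *)
Definition same_leaf (R : realType) (p n : nat) (V : nat -> 'I_p) (S : nat -> R)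
    (x x' : 'rV[R]_p) : Prop :=
  forall k, (k < n)%N ->
    (x 0 (V k) < S k /\ x' 0 (V k) < S k) \/
    (S k <= x 0 (V k) /\ S k <= x' 0 (V k)).

(* D ~ fD and, given D = n, the variables V_0, ..., V_(n-1), S_0, ..., S_(n-1)
   are independent, each V_k with mass function fV and each S_k with density fS
   on [0, 1].  The conditional law is written multiplied by P (D = n), so it
   says nothing when that probability is 0; the laws of V_k and S_k on the event
   D <= k are unconstrained. *)
Record symmetric_tree_prior (R : realType) (p : nat)
    (fD : nat -> R) (fV : 'I_p -> R) (fS : R -> R)
    (d : measure_display) (T : measurableType d) (P : probability T R)
    (D : {RV P >-> nat}) (V : nat -> T -> 'I_p) (S : nat -> {RV P >-> R})
    : Prop := SymmetricTreePrior {
  split_variable_measurable : forall k v, measurable (V k @^-1` [set v]);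
  depth_law : forall n, P (D @^-1` [set n]) = (fD n)%:E;
  rules_law : forall n (A : nat -> {set 'I_p}) (B : nat -> set R),
    (forall k, measurable (B k)) ->
    P (D @^-1` [set n] `&`
       \bigcap_(k in `I_n) (V k @^-1` [set` A k] `&` S k @^-1` B k)) =
    (P (D @^-1` [set n]) *
     (\prod_(k < n) ((\sum_(v in A k) fV v) * density_prob fS (B k)))%:E)%E
}.

Definition kBART (R : realType) (p : nat) (sigma_mu : R)
    (d : measure_display) (T : measurableType d) (P : probability T R)
    (D : {RV P >-> nat}) (V : nat -> T -> 'I_p) (S : nat -> {RV P >-> R})
    (x x' : 'rV[R]_p) : R :=
  sigma_mu ^+ 2 *
  fine (P [set w | same_leaf (D w) (fun k => V k w) (fun k => S k w) x x']).

Definition dBART (R : realType) (p : nat) (fV : 'I_p -> R) (fS : R -> R)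
    (x x' : 'rV[R]_p) : R :=
  \sum_v fV v * `|density_cdf fS (x 0 v) - density_cdf fS (x' 0 v)|.

Definition conditional_prob (R : realType) (d : measure_display)
    (T : measurableType d) (P : probability T R) (A B : set T) : R :=
  fine (P (A `&` B)) / fine (P B).

(* Main.v *)
Require Import Defs.
From HB Require Import structures.
From mathcomp Require Import all_boot all_order all_algebra.
From mathcomp Require Import all_classical all_reals all_analysis.
From mathcomp Require Import ring.
Import Order.TTheory GRing.Theory Num.Theory.
Import numFieldNormedType.Exports.
Local Open Scope classical_set_scope.
Local Open Scope ring_scope.

Set Implicit Arguments.
Unset Strict Implicit.

(** Two points lie in the same leaf exactly when none of the D splits separates
    them.  A single split separates x and x' when its variable is some v and its
    threshold falls between x_v and x'_v, so a random split does so with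
    probability
      sum_v f_V(v) |F_S(x_v) - F_S(x'_v)| = d_BART(x, x').
    The splits being independent given D, the points stay together with
    conditional probability (1 - d_BART)^D, and the kernel is, up to the factor
    sigma_mu^2, the probability generating function of D at z = 1 - d_BART.
    For a Poisson law conditioned to be positive that generating function is
      e^(-r) (e^(r z) - 1) / (1 - e^(-r)),
    which is the claimed formula since r z - r = - r d_BART.

    The probability of agreement at one split is [density_prob_agreeing].  The
    prior gives probabilities of product events only, while agreement couples a
    split variable with its threshold; [prob_leaf_event] cuts the same-leaf event
    into the product events obtained by fixing all split variables, and the
    resulting sum over assignments refactors into an n-th power.
    [prob_same_leaf] sums over the depth, and [zero_truncated_poisson_pgf]
    evaluates the series. *)

Section ThresholdLaw.
Context (R : realType).
Implicit Types (f : R -> R) (A B : set R).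

Lemma density_prob_setU f A B : positive_unit_density f ->
    measurable A -> measurable B -> A `&` B = set0 ->
  density_prob f (A `|` B) = density_prob f A + density_prob f B.
Proof.
move=> [fcont _ _] mA mB AB0; rewrite /density_prob setIUl.
have mI : measurable (`[0, 1] : set R) by exact: measurable_itv.
have mAI : measurable (A `&` `[0, 1]) by exact: measurableI.
have mBI : measurable (B `&` `[0, 1]) by exact: measurableI.
apply: Rintegral_setU => //.
- apply: (@integrableS _ _ _ lebesgue_measure `[0, 1]) => //.
  + exact: measurableU.
  + by rewrite -setIUl; exact: subIsetr.
  + by apply: continuous_compact_integrable => //; exact: segment_compact.
- by rewrite disj_set2E; apply/eqP; rewrite setIACA AB0 set0I.
Qed.

Lemma density_prob_setT f : positive_unit_density f -> density_prob f setT = 1.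
Proof. by move=> [_ _ f1]; rewrite /density_prob setTI. Qed.

Lemma density_prob_ge0 f A : positive_unit_density f -> 0 <= density_prob f A.
Proof.
move=> [_ fgt0 _]; apply: Rintegral_ge0 => t [_ /=].
by rewrite in_itv /= => /fgt0 /ltW.
Qed.

(** Thresholds that send both coordinates to the same side; the disjunction
    matches the clause of [same_leaf], ties going to the right. *)
Definition agreeing_thresholds (u u' : R) : set R :=
  [set s | (u < s /\ u' < s) \/ (s <= u /\ s <= u')].

Lemma agreeing_thresholdsC u u' :
  agreeing_thresholds u u' = agreeing_thresholds u' u.
Proof. by apply/seteqP; split => s /= [] [? ?]; [left|right|left|right]. Qed.

Lemma agreeing_thresholdsE u u' : u <= u' ->
  agreeing_thresholds u u' = ~` `]u, u'].
Proof.
move=> uu'; apply/seteqP; split=> s /=; rewrite in_itv /=.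
  by move=> [[us u's]|[su su']]; apply/negP; rewrite negb_and -!leNgt -ltNge;
    rewrite ?u's ?su ?orbT.
move=> /negP; rewrite negb_and -leNgt -ltNge => /orP[su|u's].
  by right; split => //; exact: le_trans su uu'.
by left; split => //; exact: le_lt_trans uu' u's.
Qed.

Lemma measurable_agreeing_thresholds u u' :
  measurable (agreeing_thresholds u u').
Proof.
have [uu'|/ltW uu'] := leP u u'; last rewrite agreeing_thresholdsC;
  by rewrite agreeing_thresholdsE//; apply: measurableC; exact: measurable_itv.
Qed.

(** The complement of the agreeing thresholds is the half-open interval between
    the two coordinates, whose mass is an increment of the distribution
    function. *)
Lemma density_prob_agreeing f u u' : positive_unit_density f ->
  density_prob f (agreeing_thresholds u u') =
  1 - `|density_cdf f u - density_cdf f u'|.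
Proof.
move=> fP.
wlog uu' : u u' / u <= u'.
  move=> H; have [/H//|/ltW/H] := leP u u'.
  by rewrite agreeing_thresholdsC distrC.
have mI : measurable (`]u, u'] : set R) by exact: measurable_itv.
have splitT : density_prob f `]u, u'] + density_prob f (~` `]u, u']) = 1.
  rewrite -density_prob_setU ?setUv ?setICr ?density_prob_setT//.
  exact: measurableC.
have splitF : density_cdf f u' = density_cdf f u + density_prob f `]u, u'].
  rewrite /density_cdf -density_prob_setU//.
    congr density_prob; apply/seteqP; split=> s /=; rewrite !in_itv /=.
      by move=> su'; have [su|us] := leP s u; [left|right].
    by move=> [su|/andP[]//]; exact: le_trans su uu'.
  apply/seteqP; split=> s //= []; rewrite !in_itv /= => su /andP[us _].
  by move: us; rewrite ltNge su.
rewrite agreeing_thresholdsE// splitF opprD addrA subrr add0r normrN.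
by rewrite ger0_norm ?density_prob_ge0// -splitT [X in X - _]addrC addrK.
Qed.

End ThresholdLaw.

Section SameLeafProbability.
Context (R : realType) (p : nat) (fD : nat -> R) (fV : 'I_p -> R) (fS : R -> R)
  (d : measure_display) (T : measurableType d) (P : probability T R)
  (D : {RV P >-> nat}) (V : nat -> T -> 'I_p) (S : nat -> {RV P >-> R}).
Hypotheses (fV_pmf : positive_finite_pmf fV)
  (fS_density : positive_unit_density fS)
  (prior : symmetric_tree_prior fD fV fS D V S).
Variables (x x' : 'rV[R]_p).

Let agree (v : 'I_p) := agreeing_thresholds (x 0 v) (x' 0 v).

Let leaf_event (n : nat) : set T := D @^-1` [set n] `&`
  [set w | same_leaf n (fun k => V k w) (fun k => S k w) x x'].

(** The part of the same-leaf event at depth n where the split variables are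
    phi.  The law of the rules takes families indexed by all k : nat, so phi is
    extended along insub, with default values at k >= n. *)
Let cell (n : nat) (phi : {ffun 'I_n -> 'I_p}) : set T :=
  D @^-1` [set n] `&`
  \bigcap_(k in `I_n)
    (V k @^-1` [set` oapp (fun i => [set phi i]%SET) finset.set0 (insub k)] `&`
     S k @^-1` oapp (fun i => agree (phi i)) setT (insub k)).

Let cellP n (phi : {ffun 'I_n -> 'I_p}) w : cell phi w <->
  D w = n /\ forall i : 'I_n, V i w = phi i /\ agree (phi i) (S i w).
Proof.
split=> [[Dw H]|[Dw H]]; split=> //.
  move=> i; have [/=] := H i (ltn_ord i).
  by rewrite valK /= inE => /eqP ->.
move=> k /= kn; have [] := H (Ordinal kn) => /= Vk Sk.
by rewrite (insubT (fun k => k < n)%N kn) /= inE; split=> //; apply/eqP.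
Qed.

Let measurable_depth n : measurable (D @^-1` [set n]).
Proof. by rewrite -[X in measurable X]setTI; apply: measurable_funP. Qed.

Let measurable_cell n (phi : {ffun 'I_n -> 'I_p}) : measurable (cell phi).
Proof.
apply: measurableI; first exact: measurable_depth.
apply: bigcap_measurableType => k _.
apply: measurableI.
  case: insubP => [i _ _|_] /=; last first.
    by rewrite (_ : _ @^-1` _ = set0)//; apply/seteqP; split=> w //=; rewrite inE.
  rewrite (_ : _ @^-1` _ = V k @^-1` [set phi i]).
    exact: split_variable_measurable prior _ _.
  by apply/seteqP; split=> w /=; rewrite inE => /eqP.
rewrite -[X in measurable X]setTI; apply: measurable_funP => //.
by case: insubP => [i _ _|_] /=; [exact: measurable_agreeing_thresholds|].
Qed.

Let leaf_eventE n :
  leaf_event n = \bigcup_(phi in [set: {ffun 'I_n -> 'I_p}]) cell phi.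
Proof.
apply/seteqP; split=> w /=.
  move=> [Dw leaf]; exists [ffun i : 'I_n => V i w] => //; apply/cellP.
  by split=> // i; rewrite ffunE; split=> //; exact: leaf.
move=> [phi _ /cellP[Dw H]]; split=> // k kn.
by have [] := H (Ordinal kn) => /= ->.
Qed.

Let prob_cell n (phi : {ffun 'I_n -> 'I_p}) :
  P (cell phi) = (fD n * \prod_i
    (fV (phi i) * (1 - `|density_cdf fS (x 0 (phi i)) -
                         density_cdf fS (x' 0 (phi i))|)))%:E.
Proof.
rewrite (rules_law prior); last first.
  by move=> k; case: insubP => [i _ _|_] /=;
    [exact: measurable_agreeing_thresholds|].
rewrite (depth_law prior) -EFinM; congr ((_ * _)%:E).
apply: eq_bigr => i _; rewrite valK /= big_set1.
by rewrite density_prob_agreeing.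
Qed.

Lemma measurable_leaf_event n : measurable (leaf_event n).
Proof.
rewrite leaf_eventE; apply: fin_bigcup_measurable => [|phi _].
  exact: finite_finset.
exact: measurable_cell.
Qed.

(** Summing over the assignments phi of the n split variables and exchanging sum
    and product recovers the independence of the n splits: each of them fails to
    separate the points with probability 1 - d_BART. *)
Lemma prob_leaf_event n :
  P (leaf_event n) = (fD n * (1 - dBART fV fS x x') ^+ n)%:E.
Proof.
rewrite leaf_eventE measure_fin_bigcup.
- rewrite (fsbigE (index_enum _)) ?index_enum_uniq//; last first.
    by move=> phi _; rewrite mem_index_enum.
  rewrite big_mkcond /=.
  transitivity (\sum_(phi : {ffun 'I_n -> 'I_p}) (fD n * \prod_i
      (fV (phi i) * (1 - `|density_cdf fS (x 0 (phi i)) -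
                           density_cdf fS (x' 0 (phi i))|)))%:E)%E.
    by apply: eq_bigr => phi _; rewrite in_setT; exact: prob_cell.
  rewrite sumEFin -mulr_sumr; congr ((_ * _)%:E).
  rewrite -(bigA_distr_bigA (fun (i : 'I_n) v =>
    fV v * (1 - `|density_cdf fS (x 0 v) - density_cdf fS (x' 0 v)|))).
  rewrite prodr_const card_ord /=; congr (_ ^+ _).
  rewrite /dBART -[1 in RHS]fV_pmf.2 -sumrB; apply: eq_bigr => v _.
  by rewrite mulrBr mulr1.
- exact: finite_finset.
- move=> phi psi _ _ [w [/cellP[_ H] /cellP[_ H']]].
  by apply/ffunP => i; rewrite -(H i).1 -(H' i).1.
- by move=> phi _; exact: measurable_cell.
Qed.

Lemma prob_same_leaf :
  P [set w | same_leaf (D w) (fun k => V k w) (fun k => S k w) x x'] =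
  (\sum_(0 <= n <oo) (fD n * (1 - dBART fV fS x x') ^+ n)%:E)%E.
Proof.
rewrite (_ : [set w | _] = \bigcup_n leaf_event n); last first.
  apply/seteqP; split=> w /=; first by move=> leaf; exists (D w).
  by move=> [n _ [/= -> ]].
rewrite measure_bigcup.
- rewrite eseries_mkcond; apply: eq_eseriesr => n _.
  by rewrite in_setT; exact: prob_leaf_event.
- by move=> n _; exact: measurable_leaf_event.
- by move=> n m _ _ [w [[/= <- _] [/= <- _]]].
Qed.

End SameLeafProbability.

(** Writing the missing mass at 0 as a correction term lets the generating
    function be read off the exponential series without shifting indices. *)
Lemma zero_truncated_poisson (R : realType) (fD : nat -> R) (r : R)
    (d : measure_display) (T : measurableType d) (Q : probability T R)
    (W : {RV Q >-> nat}) : 0 < r ->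
    (forall n, Q (W @^-1` [set n]) = (poisson_pmf r n)%:E) ->
    (forall n, fD n =
      conditional_prob Q (W @^-1` [set n]) (W @^-1` [set m | (0 < m)%N])) ->
  forall n, fD n = expR (- r) / (1 - expR (- r)) *
                   (exp_coeff r n - (n == 0%N)%:R).
Proof.
move=> r0 Wlaw fDE n.
have mW m : measurable (W @^-1` [set m]).
  by rewrite -[X in measurable X]setTI; apply: measurable_funP.
have QW : Q (W @^-1` [set m | (0 < m)%N]) = (1 - expR (- r))%:E.
  rewrite (_ : _ @^-1` _ = ~` (W @^-1` [set 0%N])); last first.
    by apply/seteqP; split=> w /=; rewrite lt0n => /eqP.
  rewrite probability_setC// Wlaw /poisson_pmf r0 expr0 fact0 invr1 !mul1r.
  by rewrite EFinB.
rewrite fDE /conditional_prob QW /=.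
case: n => [|n].
  rewrite (_ : _ `&` _ = set0); last first.
    by apply/seteqP; split=> w //= [->].
  by rewrite measure0 /exp_coeff /= expr0 fact0 invr1 mulr1 subrr mulr0 mul0r.
rewrite (_ : _ `&` _ = W @^-1` [set n.+1]); last first.
  by apply/seteqP; split=> w //=; [case|move=> ->].
rewrite Wlaw /poisson_pmf r0 /exp_coeff /= subr0; ring.
Qed.

(** The factor c, which will be the normalization of the conditioned law, is kept
    inside the extended-real series so that the limit can be taken on real partial
    sums, where convergence of the exponential series settles it for every sign
    of c and z. *)
Lemma zero_truncated_poisson_pgf (R : realType) (c r z : R) :
  (\sum_(0 <= n <oo) (c * (exp_coeff r n - (n == 0%N)%:R) * z ^+ n)%:E =
   (c * (expR (r * z) - 1))%:E)%E.
Proof.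
apply: cvg_lim => //.
(* The partial sum of length n has lost its constant term as soon as 0 < n. *)
have -> : (fun n => \sum_(0 <= i < n)
     (c * (exp_coeff r i - (i == 0%N)%:R) * z ^+ i)%:E)%E =
  EFin \o (fun n => c * (series (exp_coeff (r * z)) n - (0 < n)%N%:R)).
  apply/funext => n /=; rewrite sumEFin; congr EFin.
  rewrite /series /=; case: n => [|n]; first by rewrite !big_geq// subr0 mulr0.
  rewrite !big_nat_recl//= /exp_coeff /= !expr0 fact0 invr1 !mulr1 subrr mulr0.
  rewrite add0r addrAC subrr add0r mulr_sumr; apply: eq_bigr => i _.
  by rewrite subr0 exprMn; ring.
apply: cvg_EFin; first exact: nearW.
apply: cvgMl_tmp; apply: cvgB; first exact: is_cvg_series_exp_coeff.
apply/cvgrPdist_lt => e e0; near=> n.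
rewrite (_ : (0 < n)%N) ?subrr ?normr0//.
by near: n; exists 1%N.
Unshelve. all: end_near.
Qed.

Unset Implicit Arguments.

Theorem corollary3p1 (R : realType) (p : nat) (p_ge1 : (1 <= p)%N)
  (sigma_mu : R) (sigma_mu_gt0 : 0 < sigma_mu ^+ 2)
  (fD : nat -> R) (fD_pmf : positive_nat_pmf fD)
  (fV : 'I_p -> R) (fV_pmf : positive_finite_pmf fV)
  (fS : R -> R) (fS_density : positive_unit_density fS)
  (d : measure_display) (T : measurableType d) (P : probability T R)
  (D : {RV P >-> nat}) (V : nat -> T -> 'I_p) (S : nat -> {RV P >-> R})
  (prior : symmetric_tree_prior fD fV fS D V S)
  (r : R) (r_gt0 : 0 < r)
  (d' : measure_display) (T' : measurableType d') (Q : probability T' R)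
  (W : {RV Q >-> nat})
  (W_poisson : forall n, Q (W @^-1` [set n]) = (poisson_pmf r n)%:E)
  (D_law : forall n, fD n =
     conditional_prob Q (W @^-1` [set n]) (W @^-1` [set m | (0 < m)%N]))
  (x x' : 'rV[R]_p) (hx : unit_cube x) (hx' : unit_cube x') :
  kBART sigma_mu D V S x x' =
    sigma_mu ^+ 2 / (1 - expR (- r)) *
    (expR (- (r * dBART fV fS x x')) - expR (- r)).
Proof.
rewrite /kBART (prob_same_leaf fV_pmf fS_density prior).
under eq_eseriesr => n _
  do rewrite (zero_truncated_poisson r_gt0 W_poisson D_law n).
rewrite zero_truncated_poisson_pgf /= mulrBr mulr1 mulrBr.
have -> : expR (- (r * dBART fV fS x x')) =
    expR (- r) * expR (r * (1 - dBART fV fS x x')).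
  by rewrite -expRD; congr expR; ring.
ring.
Qed.
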